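(* (i) For every $n\geq 2$, $\chi_d^t(P_n\circ K_1)=n+1$. (ii) For every $n\geq 3$, $\chi_d^t(C_n\circ K_1)=n+1$.
   Context: $P_n$ is the path on $n$ vertices, $C_n$ the cycle on $n$ vertices, $K_1$ the single-vertex graph. For graphs $G$ and $H$, the corona $G\circ H$ is obtained from the disjoint union of $G$ and $|V(G)|$ copies of $H$ by joining the $i$-th vertex of $G$ to all vertices of the $i$-th copy of $H$; thus $G\circ K_1$ attaches one pendant vertex to each vertex of $G$. For a graph with no isolated vertex, a total dominator coloring (TD-coloring) is a proper vertex coloring in which every vertex is adjacent to every vertex of some color class (a class other than its own); $\chi_d^t$ denotes the minimum number of colors in such a coloring. *)

(* Defs.v *)
From mathcomp Require Import all_boot.

Set Implicit Arguments.
Unset Strict Implicit.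
Unset Printing Implicit Defensive.

Record sgraph := SGraph {
  vertex :> finType;
  adj : rel vertex;
  adj_sym : symmetric adj;
  adj_irrefl : irreflexive adj
}.

Definition path_rel n : rel 'I_n :=
  fun i j => (i.+1 == j :> nat) || (j.+1 == i :> nat).

Lemma path_rel_sym n : symmetric (@path_rel n).
Proof. by move=> i j; rewrite /path_rel orbC. Qed.

Lemma path_rel_irrefl n : irreflexive (@path_rel n).
Proof. by move=> i; rewrite /path_rel orbb; apply/negbTE; rewrite gtn_eqF. Qed.

Definition path_graph n := SGraph (@path_rel_sym n) (@path_rel_irrefl n).

(* The conjunct [i != j] only matters for n = 1, where it excludes a loop. *)
Definition cycle_rel n : rel 'I_n :=
  fun i j => (i != j) && ((i.+1 %% n == j) || (j.+1 %% n == i)).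

Lemma cycle_rel_sym n : symmetric (@cycle_rel n).
Proof. by move=> i j; rewrite /cycle_rel eq_sym orbC. Qed.

Lemma cycle_rel_irrefl n : irreflexive (@cycle_rel n).
Proof. by move=> i; rewrite /cycle_rel eqxx. Qed.

Definition cycle_graph n := SGraph (@cycle_rel_sym n) (@cycle_rel_irrefl n).

Definition complete_rel n : rel 'I_n := fun i j => i != j.

Lemma complete_rel_sym n : symmetric (@complete_rel n).
Proof. by move=> i j; rewrite /complete_rel eq_sym. Qed.

Lemma complete_rel_irrefl n : irreflexive (@complete_rel n).
Proof. by move=> i; rewrite /complete_rel eqxx. Qed.

Definition complete_graph n :=
  SGraph (@complete_rel_sym n) (@complete_rel_irrefl n).

(* [inl g] is the vertex g of G; [inr (g, h)] is the vertex h in the copy of H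
   attached to g. *)
Definition corona_rel (G H : sgraph) : rel (G + G * H)%type :=
  fun x y => match x, y with
  | inl g, inl g' => adj g g'
  | inl g, inr (g', _) => g == g'
  | inr (g, _), inl g' => g == g'
  | inr (g, h), inr (g', h') => (g == g') && adj h h'
  end.

Lemma corona_rel_sym (G H : sgraph) : symmetric (@corona_rel G H).
Proof.
by case=> [g|[g h]] [g'|[g' h']] /=; rewrite ?(adj_sym g) ?(adj_sym h) // eq_sym.
Qed.

Lemma corona_rel_irrefl (G H : sgraph) : irreflexive (@corona_rel G H).
Proof. by case=> [g|[g h]] /=; rewrite adj_irrefl ?andbF. Qed.

Definition corona (G H : sgraph) :=
  SGraph (@corona_rel_sym G H) (@corona_rel_irrefl G H).

Definition no_isolated (G : sgraph) : bool :=
  [forall v : G, exists w : G, adj v w].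

Section TotalDominatorColoring.
Variables (G : sgraph) (k : nat).
Implicit Type c : {ffun G -> 'I_k}.

Definition proper_coloring c : bool :=
  [forall v, forall w, adj v w ==> (c v != c w)].

Definition color_class c (a : 'I_k) : {set G} := [set w | c w == a].

(* A color that is not used gives no color class, hence the nonemptiness
   condition: otherwise an unused color would be vacuously dominated. *)
Definition td_coloring c : bool :=
  proper_coloring c &&
  [forall v, exists a : 'I_k,
     [&& color_class c a != set0,
         v \notin color_class c a &
         [forall w in color_class c a, adj v w]]].

End TotalDominatorColoring.

Definition td_colorable (G : sgraph) (k : nat) : bool :=
  [exists c : {ffun G -> 'I_k}, td_coloring c].

(* The least k <= #|G| such that G has a TD-coloring with k colors, and the
   junk value #|G| + 1 when there is none, i.e. when G has an isolated vertex;
   see td_chiP. *)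
Definition td_chi (G : sgraph) : nat :=
  find (td_colorable G) (iota 0 #|G|.+1).

Lemma td_colorable_card (G : sgraph) : no_isolated G -> td_colorable G #|G|.
Proof.
move=> /forallP noiso; apply/existsP; exists [ffun v => enum_rank v].
apply/andP; split.
  apply/forallP=> v; apply/forallP=> w; apply/implyP=> vw; rewrite !ffunE.
  by apply: contraTneq vw => /enum_rank_inj ->; rewrite adj_irrefl.
apply/forallP=> v; have /existsP[w vw] := noiso v.
apply/existsP; exists (enum_rank w); apply/and3P; split.
- by apply/set0Pn; exists w; rewrite inE ffunE.
- rewrite inE ffunE; apply: contraTneq vw => /enum_rank_inj ->.
  by rewrite adj_irrefl.
- by apply/forallP=> u; apply/implyP; rewrite inE ffunE => /eqP/enum_rank_inj ->.
Qed.

Lemma td_chiP (G : sgraph) : no_isolated G ->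
  td_colorable G (td_chi G) /\ (forall k, td_colorable G k -> td_chi G <= k).
Proof.
move=> /td_colorable_card colG.
have hasG : has (td_colorable G) (iota 0 #|G|.+1).
  by apply/hasP; exists #|G| => //; rewrite mem_iota /=.
have ltG : td_chi G < #|G|.+1.
  by rewrite -[X in _ < X](size_iota 0) -has_find.
split; first by have := nth_find 0 hasG; rewrite nth_iota.
move=> k colk; rewrite leqNgt; apply/negP => ltk.
have := before_find 0 ltk.
by rewrite nth_iota ?add0n ?colk // (ltn_trans ltk).
Qed.

Lemma corona_no_isolated (G H : sgraph) (h : H) : no_isolated (corona G H).
Proof.
apply/forallP=> -[g|[g h']]; apply/existsP.
  by exists (inr (g, h)) => /=.
by exists (inl g) => /=.
Qed.

(* Main.v *)
Require Import Defs.
From mathcomp Require Import all_boot.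

(** In a TD-coloring of G o K_1 each pendant vertex has a single neighbor, so
    that neighbor forms a color class of its own: the vertices of G use up
    |G| colors, none of which is available for a pendant vertex, whence at
    least |G| + 1 colors. Conversely, if G has no isolated vertex, giving all
    the vertices of G different colors and all the pendant vertices one further
    color is a TD-coloring. Only the absence of isolated vertices in P_n and
    C_n matters. *)

Lemma td_colorable_corona_K1_leq (G : sgraph) (k : nat) (g0 : G) :
  td_colorable (corona G (complete_graph 1)) k -> #|G| < k.
Proof.
case/existsP=> c /andP[_ /forallP dom].
have single g w : c w = c (inl g) -> w = inl g.
  have /existsP[a /and3P[/set0Pn[u ua] _ /forallP all_adj]] :=
    dom (inr (g, ord0)).
  have class_g v : v \in color_class c a -> v = inl g.
    move=> va; have := all_adj v; rewrite va.
    by case: v {va} => [g'|[g' h]] /= => [/eqP->|]; rewrite ?ord1 ?andbF.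
  (* Nonemptiness of the dominated class matters here: its element [u] must be [inl g], which
     identifies [a] as [c (inl g)]. *)
  move: (ua); rewrite (class_g u ua) inE => /eqP ca cw.
  by apply: class_g; rewrite inE cw ca.
(* [None] stands for one pendant vertex, whose color [single] separates from those of G. *)
pose f (x : option G) : 'I_k :=
  if x is Some g then c (inl g) else c (inr (g0, ord0)).
have f_inj : injective f.
  by case=> [g|] [g'|] //= => [/single[->]|/esym/single|/single].
by have := leq_card f f_inj; rewrite card_option card_ord.
Qed.

Lemma td_colorable_corona_K1 (G : sgraph) :
  no_isolated G -> td_colorable (corona G (complete_graph 1)) #|G|.+1.
Proof.
move=> /forallP noiso.
(* [lift ord_max] skips [ord_max], which is reserved for the pendant vertices. *)
pose c : {ffun corona G (complete_graph 1) -> 'I_#|G|.+1} :=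
  [ffun x => if x is inl g then lift ord_max (enum_rank g) else ord_max].
have c_inl g w : (c w == c (inl g)) = (w == inl g).
  apply/eqP/eqP=> [|-> //]; rewrite !ffunE.
  case: w => [g' /lift_inj/enum_rank_inj-> //|p /eqP].
  by rewrite (negbTE (neq_lift _ _)).
(* By [c_inl] the class of [inl g] is a singleton, so being adjacent to [inl g] suffices to dominate
   it. *)
have dominated (v : corona G (complete_graph 1)) (g : G) :
    corona_rel v (inl g) ->
    [exists a, [&& color_class c a != set0, v \notin color_class c a &
                   [forall w in color_class c a, adj v w]]].
  move=> vg; apply/existsP; exists (c (inl g)); apply/and3P; split.
  - by apply/set0Pn; exists (inl g); rewrite inE.
  - by rewrite inE c_inl; apply: contraTneq vg => ->; rewrite corona_rel_irrefl.
  - by apply/forallP=> w; apply/implyP; rewrite inE c_inl => /eqP->.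
apply/existsP; exists c; apply/andP; split.
  apply/forallP=> v; apply/forallP=> w; apply/implyP=> vw.
  have neq_vw : v != w by apply: contraTneq vw => ->; rewrite adj_irrefl.
  (* An edge with an end in G is settled by [c_inl]; two pendant vertices are never adjacent, as K_1
     has no edge. *)
  case: w vw neq_vw => [g _|[g h]]; first by rewrite c_inl.
  case: v => [g' _|[g' h']]; first by rewrite [c _ == _]eq_sym c_inl.
  by rewrite /= [h]ord1 [h']ord1 /complete_rel eqxx andbF.
apply/forallP=> -[g|[g h]]; last exact: (dominated (inr (g, h)) g (eqxx g)).
by have /existsP[g' gg'] := noiso g; apply: (dominated _ g').
Qed.

Lemma td_chi_corona_K1 (G : sgraph) (g0 : G) :
  no_isolated G -> td_chi (corona G (complete_graph 1)) = #|G| + 1.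
Proof.
move=> noiso; rewrite addn1.
have [col min_col] := td_chiP (corona_no_isolated G (ord0 : complete_graph 1)).
apply/eqP; rewrite eqn_leq min_col ?td_colorable_corona_K1 //.
exact: td_colorable_corona_K1_leq g0 col.
Qed.

Lemma path_no_isolated n : 1 < n -> no_isolated (path_graph n).
Proof.
move=> n_gt1; apply/forallP=> -[[|i] lt_in]; apply/existsP.
  by exists (Ordinal n_gt1).
by exists (Ordinal (ltnW lt_in)); rewrite /= /path_rel /= eqxx orbT.
Qed.

Lemma cycle_no_isolated n : 1 < n -> no_isolated (cycle_graph n).
Proof.
move=> n_gt1; have n_gt0 := ltnW n_gt1.
apply/forallP=> -[i lt_in]; apply/existsP.
exists (Ordinal (ltn_pmod i.+1 n_gt0)).
rewrite /= /cycle_rel /= eqxx andbT -val_eqE /=.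
(* The successor mod n must differ from [i]: it wraps around to 0 only from [i = n - 1], which is
   nonzero since [1 < n]. *)
have [lt_Sin | ] := ltnP i.+1 n; first by rewrite modn_small // ltn_eqF.
move=> le_nSi; have -> : i.+1 = n by apply/eqP; rewrite eqn_leq lt_in.
by rewrite modnn; case: i lt_in le_nSi => // _; rewrite leqNgt n_gt1.
Qed.

Theorem theorem2p4 :
  (forall n : nat, 2 <= n ->
     td_chi (corona (path_graph n) (complete_graph 1)) = n + 1) /\
  (forall n : nat, 3 <= n ->
     td_chi (corona (cycle_graph n) (complete_graph 1)) = n + 1).
Proof.
split=> n n_gt.
  rewrite (td_chi_corona_K1 (path_graph n) (Ordinal (ltnW n_gt))) ?card_ord //.
  exact: path_no_isolated.
rewrite (td_chi_corona_K1 (cycle_graph n) (Ordinal (ltnW (ltnW n_gt)))).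
  by rewrite card_ord.
exact/cycle_no_isolated/ltnW.
Qed.
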